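(* Let $H=K\,\triangleright\!\!\!\blacktriangleleft L$ be a Hopf algebra with the structure of a (right–left) bicrossproduct of Hopf algebras $K$ and $L$, let $\langle\cdot,\cdot\rangle_1$ and $\langle\cdot,\cdot\rangle_2$ be nondegenerate Hopf algebra pairings for the pairs $(K,K^* )$ and $(L,L^* )$ respectively, and let $H^*=K^*\blacktriangleright\!\!\!\triangleleft\, L^*$ be the dual (left–right) bicrossproduct Hopf algebra. Then the expression $$\langle kl,\kappa\lambda\rangle=\langle k,\kappa\rangle_1\,\langle l,\lambda\rangle_2,\qquad k\in K,\ l\in L,\ \kappa\in K^*,\ \lambda\in L^*,$$ (extended bilinearly) defines a nondegenerate Hopf algebra pairing between $H$ and $H^*$.
   Context: The base field $\mathbb{K}$ is $\mathbb{R}$ or $\mathbb{C}$. Sweedler notation $\Delta(c)=c_{(1)}\otimes c_{(2)}$ is used. Pairing: a pairing between Hopf algebras $H$ and $H'$ is a bilinear map $\langle\cdot,\cdot\rangle:H\times H'\to\mathbb{K}$ with $\langle h,h'k'\rangle=\langle\Delta(h),h'\otimes k'\rangle$, $\langle h,1_{H'}\rangle=\epsilon(h)$, $\langle h\otimes k,\Delta'(h')\rangle=\langle hk,h'\rangle$, $\epsilon'(h')=\langle 1_H,h'\rangle$, $\langle h,S'(h')\rangle=\langle S(h),h'\rangle$, where $\langle h\otimes k,h'\otimes k'\rangle=\langle h,h'\rangle\langle k,k'\rangle$. It is nondegenerate if $\langle h,\cdot\rangle=0$ implies $h=0$ and $\langle\cdot,h'\rangle=0$ implies $h'=0$. Right–left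 bicrossproduct: $L$ is a right $K$-module algebra with action $l\triangleleft k$ (i.e. $(ll')\triangleleft k=(l\triangleleft k_{(1)})(l'\triangleleft k_{(2)})$, $1\triangleleft k=\epsilon(k)1$), and $K$ is a left $L$-comodule coalgebra with coaction $k\mapsto k\blacktriangleleft\,=k^{(1)}\otimes k^{(2)}\in L\otimes K$ (i.e. $k^{(1)}\otimes {k^{(2)}}_{(1)}\otimes{k^{(2)}}_{(2)}={k_{(1)}}^{(1)}{k_{(2)}}^{(1)}\otimes{k_{(1)}}^{(2)}\otimes{k_{(2)}}^{(2)}$ and $k^{(1)}\epsilon(k^{(2)})=\epsilon(k)1_L$), satisfying $\epsilon(l\triangleleft k)=\epsilon(l)\epsilon(k)$; $\Delta(l\triangleleft k)=(l_{(1)}\triangleleft k_{(1)}){k_{(2)}}^{(1)}\otimes l_{(2)}\triangleleft{k_{(2)}}^{(2)}$; $1\blacktriangleleft\,=1\otimes1$; $(kk')\blacktriangleleft\,=(k^{(1)}\triangleleft k'_{(1)}){k'_{(2)}}^{(1)}\otimes k^{(2)}{k'_{(2)}}^{(2)}$; ${k_{(1)}}^{(1)}(l\triangleleft k_{(2)})\otimes{k_{(1)}}^{(2)}=(l\triangleleft k_{(1)}){k_{(2)}}^{(1)}\otimes{k_{(2)}}^{(2)}$. Then $H=K\triangleright\!\!\!\blacktriangleleft L$ is the vector space $K\otimes L$ (write $kl=k\otimes l$) with product $(k\otimes l)(k'\otimes l')=kk'_{(1)}\otimes(l\triangleleft k'_{(2)})l'$, coproduct $\Delta(k\otimes l)=k_{(1)}\otimes{k_{(2)}}^{(1)}l_{(1)}\otimes{k_{(2)}}^{(2)}\otimes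 l_{(2)}$, counit $\epsilon(k\otimes l)=\epsilon(k)\epsilon(l)$, antipode $S(k\otimes l)=(1\otimes S(k^{(1)}l))(S(k^{(2)})\otimes1)$. Dual: $K^*$ and $L^*$ denote Hopf algebras in nondegenerate duality with $K$ and $L$ (not necessarily full linear duals). $H^*=K^*\blacktriangleright\!\!\!\triangleleft L^*$ is the vector space $K^*\otimes L^*$ (write $\kappa\lambda=\kappa\otimes\lambda$), where $K^*$ is a left $L^*$-module algebra (action $\lambda\triangleright\kappa$) and $L^*$ is a right $K^*$-comodule coalgebra (coaction $\lambda\mapsto\lambda^{(1)}\otimes\lambda^{(2)}\in L^*\otimes K^*$), these being dual, respectively, to the left coaction $k\mapsto k^{(1)}\otimes k^{(2)}\in L\otimes K$ of $L$ on $K$ and to the right action $l\triangleleft k$ of $K$ on $L$: $\langle k,\lambda\triangleright\kappa\rangle_1=\langle k^{(1)},\lambda\rangle_2\langle k^{(2)},\kappa\rangle_1$ and $\langle l\triangleleft k,\lambda\rangle_2=\langle l,\lambda^{(1)}\rangle_2\langle k,\lambda^{(2)}\rangle_1$; it is a Hopf algebra with product $(\kappa\lambda)(\kappa'\lambda')=\kappa(\lambda_{(1)}\triangleright\kappa')\,\lambda_{(2)}\lambda'$, coproduct $\Delta(\kappa\lambda)=\kappa_{(1)}{\lambda_{(1)}}^{(1)}\otimes\kappa_{(2)}{\lambda_{(1)}}^{(2)}\lambda_{(2)}$ and counit $\epsilon(\kappa)\epsilon(\lambda)$. *)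

(* Defs.v *)
From HB Require Import structures.
From mathcomp Require Import all_boot all_algebra.
From mathcomp Require Import boolp reals.
From mathcomp Require Import complex.
Set Implicit Arguments.
Unset Strict Implicit.
Unset Printing Implicit Defensive.

Import GRing.Theory.
Local Open Scope ring_scope.
Local Open Scope quotient_scope.

Reserved Notation "u ⊗ v" (at level 40, left associativity).
Reserved Notation "\tsum_ ( a , b <- t ) E"
  (at level 41, a name, b name, t at level 99, E at level 41, right associativity,
   format "'[' \tsum_ ( a ,  b  <-  t ) '/  '  E ']'").

Variant scalars := RealScalars | ComplexScalars.

Definition scalar_field (R : realType) (s : scalars) : fieldType :=
  match s with
  | RealScalars => R : fieldType
  | ComplexScalars => R[i] : fieldType
  end.

(** Tensor product of two vector spaces: a finite sequence
    [(u_1, v_1), ..., (u_n, v_n)] stands for the sum of the [u_i ⊗ v_i], and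
    sequences are identified by the congruence generated by bilinearity. *)

Section TensorRel.
Variables (F : fieldType) (U V : lmodType F).

Inductive tens_rel : seq (U * V) -> seq (U * V) -> Prop :=
| tens_rel_refl s : tens_rel s s
| tens_rel_sym s t : tens_rel s t -> tens_rel t s
| tens_rel_trans s t r : tens_rel s t -> tens_rel t r -> tens_rel s r
| tens_rel_cat s1 s2 t1 t2 :
    tens_rel s1 t1 -> tens_rel s2 t2 -> tens_rel (s1 ++ s2) (t1 ++ t2)
| tens_rel_catC s t : tens_rel (s ++ t) (t ++ s)
| tens_rel_zero v : tens_rel [:: (0, v)] [::]
| tens_rel_addl u u' v : tens_rel [:: (u + u', v)] [:: (u, v); (u', v)]
| tens_rel_addr u v v' : tens_rel [:: (u, v + v')] [:: (u, v); (u, v')]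
| tens_rel_scale a u v : tens_rel [:: (a *: u, v)] [:: (u, a *: v)].

Definition tens_relb (s t : seq (U * V)) : bool := `[< tens_rel s t >].

Lemma tens_relb_refl : reflexive tens_relb.
Proof. by move=> s; apply/asboolP; exact: tens_rel_refl. Qed.

Lemma tens_relb_sym : symmetric tens_relb.
Proof. by move=> s t; apply/asboolP/asboolP; exact: tens_rel_sym. Qed.

Lemma tens_relb_trans : transitive tens_relb.
Proof.
move=> t s r /asboolP st /asboolP tr; apply/asboolP; exact: tens_rel_trans st tr.
Qed.

Canonical tens_equiv :=
  EquivRel tens_relb tens_relb_refl tens_relb_sym tens_relb_trans.

Definition tensor : Type := {eq_quot tens_equiv}.
HB.instance Definition _ := Choice.on tensor.
HB.instance Definition _ := EqQuotient.on tensor.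

Lemma tensP s t : (\pi_tensor s = \pi_tensor t) <-> tens_rel s t.
Proof. by split=> [/eqmodP/asboolP //|st]; apply/eqmodP/asboolP. Qed.

Lemma repr_pi s : tens_rel (repr (\pi_tensor s)) s.
Proof. by apply/tensP; rewrite reprK. Qed.

Definition tens (u : U) (v : V) : tensor := \pi_tensor [:: (u, v)].

Definition scale_seq (a : F) (s : seq (U * V)) := [seq (a *: x.1, x.2) | x <- s].

Lemma scale_seq_rel a s t :
  tens_rel s t -> tens_rel (scale_seq a s) (scale_seq a t).
Proof.
elim=> {s t} [s|s t _|s t r _ st _|s1 s2 t1 t2 _ h1 _ h2|s t|v|u u' v|u v v'|b u v].
- exact: tens_rel_refl.
- exact: tens_rel_sym.
- exact: tens_rel_trans st.
- by rewrite /scale_seq !map_cat; exact: tens_rel_cat.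
- by rewrite /scale_seq !map_cat; exact: tens_rel_catC.
- by rewrite /scale_seq /= scaler0; exact: tens_rel_zero.
- by rewrite /scale_seq /= scalerDr; exact: tens_rel_addl.
- exact: tens_rel_addr.
- rewrite /scale_seq /= scalerA mulrC -scalerA; exact: tens_rel_scale.
Qed.

Definition tzero : tensor := \pi_tensor [::].
Definition tadd (x y : tensor) : tensor := \pi_tensor (repr x ++ repr y).
Definition tscale (a : F) (x : tensor) : tensor := \pi_tensor (scale_seq a (repr x)).
Definition topp (x : tensor) : tensor := tscale (-1) x.

Lemma tadd_pi s t : tadd (\pi_tensor s) (\pi_tensor t) = \pi_tensor (s ++ t).
Proof. by apply/tensP; apply: tens_rel_cat; exact: repr_pi. Qed.

Lemma tscale_pi a s : tscale a (\pi_tensor s) = \pi_tensor (scale_seq a s).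
Proof. by apply/tensP; apply: scale_seq_rel; exact: repr_pi. Qed.

Lemma tensor_surj (x : tensor) : exists s, x = \pi_tensor s.
Proof. by exists (repr x); rewrite reprK. Qed.

Lemma taddA : associative tadd.
Proof.
move=> x y z; have [s ->] := tensor_surj x; have [t ->] := tensor_surj y.
by have [r ->] := tensor_surj z; rewrite !tadd_pi catA.
Qed.

Lemma taddC : commutative tadd.
Proof. by move=> x y; apply/tensP; exact: tens_rel_catC. Qed.

Lemma tadd0 : left_id tzero tadd.
Proof. by move=> x; have [s ->] := tensor_surj x; rewrite tadd_pi. Qed.

Lemma tens_rel_cons x s t : tens_rel s t -> tens_rel (x :: s) (x :: t).
Proof. by move=> st; apply: (@tens_rel_cat [:: x] s [:: x] t) => //; exact: tens_rel_refl. Qed.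

Lemma scale_seqDl_rel a b s :
  tens_rel (scale_seq (a + b) s) (scale_seq a s ++ scale_seq b s).
Proof.
elim: s => [|[u v] s IHs] /=; first exact: tens_rel_refl.
apply: (@tens_rel_trans _ ((a *: u, v) :: (b *: u, v) ::
                           (scale_seq a s ++ scale_seq b s))).
  apply: (@tens_rel_cat [:: ((a + b) *: u, v)] _ [:: (a *: u, v); (b *: u, v)] _) IHs.
  by rewrite scalerDl; exact: tens_rel_addl.
apply: tens_rel_cons.
rewrite -[X in tens_rel X]cat1s -[X in tens_rel _ (_ ++ X)]cat1s !catA.
by apply: tens_rel_cat; [exact: tens_rel_catC | exact: tens_rel_refl].
Qed.

Lemma scale_seq0_rel s : tens_rel (scale_seq 0 s) [::].
Proof.
elim: s => [|[u v] s IHs] /=; first exact: tens_rel_refl.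
by apply: (@tens_rel_cat [:: (0 *: u, v)] _ [::] [::]) IHs; rewrite scale0r; exact: tens_rel_zero.
Qed.

Lemma taddN : left_inverse tzero topp tadd.
Proof.
move=> x; have [s ->] := tensor_surj x.
rewrite /topp tscale_pi tadd_pi; apply/tensP.
have {2}-> : s = scale_seq 1 s.
  by rewrite /scale_seq -[LHS]map_id; apply: eq_map => -[u v]; rewrite scale1r.
apply: tens_rel_trans (tens_rel_sym (scale_seqDl_rel _ _ _)) _.
by rewrite addNr; exact: scale_seq0_rel.
Qed.

HB.instance Definition _ := GRing.isZmodule.Build tensor taddA taddC tadd0 taddN.

Lemma tscaleA a b x : tscale a (tscale b x) = tscale (a * b) x.
Proof.
have [s ->] := tensor_surj x; rewrite !tscale_pi /scale_seq -map_comp; congr (\pi_tensor _).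
by apply: eq_map => -[u v] /=; rewrite scalerA.
Qed.

Lemma tscale1 : left_id 1 tscale.
Proof.
move=> x; have [s ->] := tensor_surj x; rewrite tscale_pi; congr (\pi_tensor _).
by rewrite /scale_seq -[RHS]map_id; apply: eq_map => -[u v] /=; rewrite scale1r.
Qed.

Lemma tscaleDr : right_distributive tscale +%R.
Proof.
move=> a x y; have [s ->] := tensor_surj x; have [t ->] := tensor_surj y.
by rewrite -![_ + _]/(tadd _ _) tadd_pi !tscale_pi tadd_pi /scale_seq map_cat.
Qed.

Lemma tscaleDl x : {morph tscale^~ x : a b / a + b}.
Proof.
move=> a b; have [s ->] := tensor_surj x.
rewrite -[RHS]/(tadd _ _) !tscale_pi tadd_pi; apply/tensP.
exact: scale_seqDl_rel.
Qed.

HB.instance Definition _ := GRing.Zmodule_isLmodule.Build F tensor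
  tscaleA tscale1 tscaleDr tscaleDl.

End TensorRel.

Arguments tens {F U V} u v.
Notation "u ⊗ v" := (tens u v) : ring_scope.

(** Sweedler sums: [\tsum_(a, b <- t) E a b] chooses a decomposition of [t] as
    a sum of [a_i ⊗ b_i] and returns the sum of the [E a_i b_i].  When [E] is
    bilinear in [a] and [b] the choice is irrelevant (see [tsum_tens] and
    [tsum_is_linear]), and this is the linear map on the tensor product
    induced by [E]. *)

Definition tsum (F : fieldType) (U V : lmodType F) (W : nmodType)
    (f : U -> V -> W) (t : tensor U V) : W :=
  \sum_(x <- repr t) f x.1 x.2.

Notation "\tsum_ ( a , b <- t ) E" := (tsum (fun a b => E) t) : ring_scope.

Section TensorTheory.
Variables (F : fieldType) (U V : lmodType F).

Lemma pi_catE (s t : seq (U * V)) :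
  \pi_(tensor U V) (s ++ t) = \pi_(tensor U V) s + \pi_(tensor U V) t.
Proof. by rewrite -tadd_pi. Qed.

Lemma tens_is_bilinear :
  bilinear_for *:%R *:%R (@tens F U V : U -> V -> tensor U V).
Proof.
split=> [v a u u'|u a v v'] /=.
  have -> : a *: (u ⊗ v) = (a *: u) ⊗ v :> tensor U V by exact: tscale_pi.
  by rewrite /tens -pi_catE; apply/tensP; exact: tens_rel_addl.
have -> : a *: (u ⊗ v) = u ⊗ (a *: v) :> tensor U V.
  by rewrite [LHS]tscale_pi; apply/tensP; exact: tens_rel_scale.
by rewrite /tens -pi_catE; apply/tensP; exact: tens_rel_addr.
Qed.

HB.instance Definition _ :=
  bilinear_isBilinear.Build F U V (tensor U V) *:%R *:%R (@tens F U V)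
    tens_is_bilinear.

Lemma tensor_decomp (t : tensor U V) : \tsum_(a, b <- t) (a ⊗ b) = t.
Proof.
rewrite /tsum -[RHS]reprK; elim: (repr t) => [|[u v] s IHs].
  by rewrite big_nil.
by rewrite big_cons IHs -pi_catE.
Qed.

Variables (W : lmodType F) (f : U -> V -> W).
Hypothesis f_bilin : bilinear_for *:%R *:%R f.

Lemma tsum_pi s : tsum f (\pi_(tensor U V) s) = \sum_(x <- s) f x.1 x.2.
Proof.
have fDl u u' v : f (u + u') v = f u v + f u' v.
  by have := f_bilin.1 v 1 u u'; rewrite /= !scale1r.
have fDr u v v' : f u (v + v') = f u v + f u v'.
  by have := f_bilin.2 u 1 v v'; rewrite /= !scale1r.
have f0l v : f 0 v = 0.
  by apply: (addIr (f 0 v)); rewrite -fDl !add0r.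
have f0r u : f u 0 = 0.
  by apply: (addIr (f u 0)); rewrite -fDr !add0r.
have fZl a u v : f (a *: u) v = a *: f u v.
  by have := f_bilin.1 v a u 0; rewrite /= f0l !addr0.
have fZr a u v : f u (a *: v) = a *: f u v.
  by have := f_bilin.2 u a v 0; rewrite /= f0r !addr0.
rewrite /tsum; move: (repr_pi s); move: (repr _) => r; elim=> {r s}
  [s|s t _ ->|s t r _ -> _ ->|s1 s2 t1 t2 _ h1 _ h2|s t|v|u u' v|u v v'|b u v] //.
- by rewrite !big_cat /= h1 h2.
- by rewrite !big_cat /= addrC.
- by rewrite big_seq1 big_nil f0l.
- by rewrite !big_cons !big_nil !addr0 fDl.
- by rewrite !big_cons !big_nil !addr0 fDr.
- by rewrite !big_seq1 fZl fZr.
Qed.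

Lemma tsum_tens u v : tsum f (u ⊗ v) = f u v.
Proof. by rewrite tsum_pi big_seq1. Qed.

Lemma tsum_is_linear : linear (tsum f).
Proof.
move=> a x y; have [s ->] := tensor_surj x; have [t ->] := tensor_surj y.
have -> : a *: \pi_(tensor U V) s = \pi_(tensor U V) (scale_seq a s).
  exact: tscale_pi.
rewrite -pi_catE !tsum_pi big_cat; congr (_ + _).
rewrite /scale_seq big_map scaler_sumr; apply: eq_bigr => -[u v] _ /=.
have f0 : f 0 v = 0.
  apply: (addIr (f 0 v)); rewrite add0r.
  by have := f_bilin.1 v 1 0 0; rewrite /= !scale1r addr0 => <-.
by have := f_bilin.1 v a u 0; rewrite /= f0 !addr0.
Qed.

End TensorTheory.

HB.mixin Record isHopfAlgebra (F : fieldType) A of GRing.Algebra F A := {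
  comul : {linear A -> tensor A A};
  counit : {linear A -> F | *%R};
  antipode : {linear A -> A};
  comulA : forall x : A,
    \tsum_(a, b <- comul x) \tsum_(c, d <- comul a) (c ⊗ (d ⊗ b))
    = \tsum_(a, b <- comul x) (a ⊗ comul b);
  counit_comul : forall x : A, \tsum_(a, b <- comul x) (counit a *: b) = x;
  comul_counit : forall x : A, \tsum_(a, b <- comul x) (counit b *: a) = x;
  comul1 : comul 1 = 1 ⊗ 1;
  comulM : forall x y : A,
    comul (x * y)
    = \tsum_(a, b <- comul x) \tsum_(c, d <- comul y) ((a * c) ⊗ (b * d));
  counit1 : counit 1 = 1;
  counitM : forall x y : A, counit (x * y) = counit x * counit y;
  antipode_comul : forall x : A,
    \tsum_(a, b <- comul x) (antipode a * b) = (counit x)%:A;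
  comul_antipode : forall x : A,
    \tsum_(a, b <- comul x) (a * antipode b) = (counit x)%:A
}.

#[short(type="hopfType")]
HB.structure Definition HopfAlgebra (F : fieldType) :=
  {A of GRing.Algebra F A & isHopfAlgebra F A}.

Section Pairing.
Variables (F : fieldType) (H H' : hopfType F).
Variable p : {bilinear H -> H' -> F | *%R & *%R}.

Record hopf_pairing : Prop := HopfPairing {
  pair_mulr : forall h h' k',
    p h (h' * k') = \tsum_(h1, h2 <- comul h) (p h1 h' * p h2 k');
  pair_oner : forall h, p h 1 = counit h;
  pair_comulr : forall h k h',
    \tsum_(h'1, h'2 <- comul h') (p h h'1 * p k h'2) = p (h * k) h';
  pair_onel : forall h', counit h' = p 1 h';
  pair_antipode : forall h h', p h (antipode h') = p (antipode h) h'
}.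

Definition nondegenerate_pairing : Prop :=
  (forall h, (forall h', p h h' = 0) -> h = 0) /\
  (forall h', (forall h, p h h' = 0) -> h' = 0).

End Pairing.

Section RightLeft.
Variables (F : fieldType) (K L : hopfType F).
Variables (act : {bilinear L -> K -> L}) (coact : {linear K -> tensor L K}).
Local Notation "l ◁ k" := (act l k) (at level 38, left associativity).

Record right_module_algebra : Prop := RightModuleAlgebra {
  ract1 : forall l, l ◁ 1 = l;
  ractM : forall l k k', l ◁ (k * k') = (l ◁ k) ◁ k';
  ract_mul : forall l l' k,
    (l * l') ◁ k = \tsum_(k1, k2 <- comul k) ((l ◁ k1) * (l' ◁ k2));
  ract_one : forall k, 1 ◁ k = (counit k)%:A
}.

Record left_comodule_coalgebra : Prop := LeftComoduleCoalgebra {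
  lcoactA : forall k,
    \tsum_(x, c <- coact k) \tsum_(x1, x2 <- comul x) (x1 ⊗ (x2 ⊗ c))
    = \tsum_(x, c <- coact k) (x ⊗ coact c);
  lcoact_counitl : forall k, \tsum_(x, c <- coact k) (counit x *: c) = k;
  lcoact_comul : forall k,
    \tsum_(x, c <- coact k) (x ⊗ comul c)
    = \tsum_(k1, k2 <- comul k) \tsum_(x, c <- coact k1) \tsum_(y, d <- coact k2)
        ((x * y) ⊗ (c ⊗ d));
  lcoact_counitr : forall k,
    \tsum_(x, c <- coact k) (counit c *: x) = (counit k)%:A
}.

Record right_left_compatible : Prop := RightLeftCompatible {
  counit_ract : forall l k, counit (l ◁ k) = counit l * counit k;
  comul_ract : forall l k,
    comul (l ◁ k)
    = \tsum_(l1, l2 <- comul l) \tsum_(k1, k2 <- comul k) \tsum_(x, c <- coact k2)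
        (((l1 ◁ k1) * x) ⊗ (l2 ◁ c));
  lcoact_one : coact 1 = 1 ⊗ 1;
  lcoact_mul : forall k k',
    coact (k * k')
    = \tsum_(x, c <- coact k) \tsum_(k'1, k'2 <- comul k') \tsum_(y, d <- coact k'2)
        (((x ◁ k'1) * y) ⊗ (c * d));
  ract_lcoact : forall l k,
    \tsum_(k1, k2 <- comul k) \tsum_(x, c <- coact k1) ((x * (l ◁ k2)) ⊗ c)
    = \tsum_(k1, k2 <- comul k) \tsum_(x, c <- coact k2) (((l ◁ k1) * x) ⊗ c)
}.

(** [phi] identifies the vector space [K ⊗ L] with [H], so that [phi (k ⊗ l)]
    is the element written [kl]. *)
Record right_left_bicrossproduct (H : hopfType F)
    (phi : {linear tensor K L -> H}) : Prop := RightLeftBicrossproduct {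
  rl_module_algebra : right_module_algebra;
  rl_comodule_coalgebra : left_comodule_coalgebra;
  rl_compatible : right_left_compatible;
  rl_bij : bijective phi;
  rl_mul : forall k l k' l',
    phi (k ⊗ l) * phi (k' ⊗ l')
    = \tsum_(k'1, k'2 <- comul k') phi ((k * k'1) ⊗ ((l ◁ k'2) * l'));
  rl_comul : forall k l,
    comul (phi (k ⊗ l))
    = \tsum_(k1, k2 <- comul k) \tsum_(x, c <- coact k2) \tsum_(l1, l2 <- comul l)
        (phi (k1 ⊗ (x * l1)) ⊗ phi (c ⊗ l2));
  rl_counit : forall k l, counit (phi (k ⊗ l)) = counit k * counit l;
  rl_antipode : forall k l,
    antipode (phi (k ⊗ l))
    = \tsum_(x, c <- coact k)
        (phi (1 ⊗ antipode (x * l)) * phi (antipode c ⊗ 1))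
}.

End RightLeft.

Section LeftRight.
Variables (F : fieldType) (K L : hopfType F).
Variables (act : {bilinear L -> K -> K}) (coact : {linear L -> tensor L K}).
Local Notation "l ▷ k" := (act l k) (at level 38, left associativity).

Record left_module_algebra : Prop := LeftModuleAlgebra {
  lact1 : forall k, 1 ▷ k = k;
  lactM : forall l l' k, (l * l') ▷ k = l ▷ (l' ▷ k);
  lact_mul : forall l k k',
    l ▷ (k * k') = \tsum_(l1, l2 <- comul l) ((l1 ▷ k) * (l2 ▷ k'));
  lact_one : forall l, l ▷ 1 = (counit l)%:A
}.

Record right_comodule_coalgebra : Prop := RightComoduleCoalgebra {
  rcoactA : forall l,
    \tsum_(y, d <- coact l) \tsum_(z, e <- coact y) (z ⊗ (e ⊗ d))
    = \tsum_(y, d <- coact l) (y ⊗ comul d);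
  rcoact_counitr : forall l, \tsum_(y, d <- coact l) (counit d *: y) = l;
  rcoact_comul : forall l,
    \tsum_(y, d <- coact l) (comul y ⊗ d)
    = \tsum_(l1, l2 <- comul l) \tsum_(y, d <- coact l1) \tsum_(z, e <- coact l2)
        ((y ⊗ z) ⊗ (d * e));
  rcoact_counitl : forall l,
    \tsum_(y, d <- coact l) (counit y *: d) = (counit l)%:A
}.

Record left_right_bicrossproduct (H : hopfType F)
    (phi : {linear tensor K L -> H}) : Prop := LeftRightBicrossproduct {
  lr_module_algebra : left_module_algebra;
  lr_comodule_coalgebra : right_comodule_coalgebra;
  lr_bij : bijective phi;
  lr_mul : forall k l k' l',
    phi (k ⊗ l) * phi (k' ⊗ l')
    = \tsum_(l1, l2 <- comul l) phi ((k * (l1 ▷ k')) ⊗ (l2 * l'));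
  lr_comul : forall k l,
    comul (phi (k ⊗ l))
    = \tsum_(k1, k2 <- comul k) \tsum_(l1, l2 <- comul l) \tsum_(y, d <- coact l1)
        (phi (k1 ⊗ y) ⊗ phi ((k2 * d) ⊗ l2));
  lr_counit : forall k l, counit (phi (k ⊗ l)) = counit k * counit l
}.

End LeftRight.

Section Duality.
Variables (F : fieldType) (K L Kd Ld : hopfType F).
Variables (p1 : {bilinear K -> Kd -> F | *%R & *%R})
          (p2 : {bilinear L -> Ld -> F | *%R & *%R}).

Definition dual_action_of_coaction
    (coact : {linear K -> tensor L K}) (actd : {bilinear Ld -> Kd -> Kd}) : Prop :=
  forall k λ κ,
    p1 k (actd λ κ) = \tsum_(x, c <- coact k) (p2 x λ * p1 c κ).

Definition dual_coaction_of_action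
    (act : {bilinear L -> K -> L}) (coactd : {linear Ld -> tensor Ld Kd}) : Prop :=
  forall l k λ,
    p2 (act l k) λ = \tsum_(y, d <- coactd λ) (p2 l y * p1 k d).

End Duality.

(* Main.v *)
(* Pairing against a product in H^* unfolds the coproduct of H term by term:
   the actions and coactions of the two bicrossproducts are exchanged by the
   duality, and the products and coproducts of the factors by [p1] and [p2].
   Compatibility with the antipodes is then automatic, because [p (S h) h'] and
   [p h (S h')] are convolution inverses of the same map.  Nondegeneracy holds
   because a tensor product of nondegenerate pairings over a field is
   nondegenerate. *)
Require Import Defs.
From HB Require Import structures.
From mathcomp Require Import all_boot all_algebra.
From mathcomp Require Import boolp reals.
From mathcomp Require Import complex.
Set Implicit Arguments.
Unset Strict Implicit.
Unset Printing Implicit Defensive.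

Import GRing.Theory.
Local Open Scope ring_scope.

(** * Calculus of Sweedler sums *)

Section SweedlerSums.
Variables (F : fieldType) (U V : lmodType F).

Lemma tensor_ind (P : tensor U V -> Prop) :
    P 0 -> (forall x y, P x -> P y -> P (x + y)) -> (forall u v, P (u ⊗ v)) ->
  forall t, P t.
Proof.
move=> P0 PD Pt t; rewrite -(tensor_decomp t) /tsum.
by apply: big_ind => // i _; apply: Pt.
Qed.

Lemma eq_tsum (W : nmodType) (f g : U -> V -> W) (t : tensor U V) :
  (forall u v, f u v = g u v) -> tsum f t = tsum g t.
Proof. by move=> fg; apply: eq_bigr => i _; apply: fg. Qed.

Lemma mulr_tsuml (A : pzSemiRingType) (f : U -> V -> A) (t : tensor U V) c :
  tsum f t * c = \tsum_(a, b <- t) (f a b * c).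
Proof. exact: mulr_suml. Qed.

Lemma mulr_tsumr (A : pzSemiRingType) (f : U -> V -> A) (t : tensor U V) c :
  c * tsum f t = \tsum_(a, b <- t) (c * f a b).
Proof. exact: mulr_sumr. Qed.

Lemma exchange_tsum (U' V' : lmodType F) (W : nmodType)
    (f : U -> V -> U' -> V' -> W) (t : tensor U V) (t' : tensor U' V') :
  \tsum_(a, b <- t) \tsum_(c, d <- t') f a b c d
  = \tsum_(c, d <- t') \tsum_(a, b <- t) f a b c d.
Proof. exact: exchange_big. Qed.

(** Every [w] is summed over the same chosen decomposition of [t], so linearity holds term by
    term. *)
Lemma tsum_linear (W : lmodType F) (f : W -> U -> V -> F) (t : tensor U V) :
  (forall u v, scalar (f^~ u ^~ v)) -> scalar (fun w => tsum (f w) t).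
Proof.
move=> flin a w w'; rewrite /tsum mulr_sumr -big_split /=.
by apply: eq_bigr => i _; apply: flin.
Qed.

Lemma tsum_functional_linear (f : U -> V -> F) :
    (forall v, scalar (f^~ v)) -> (forall u, scalar (f u)) ->
  scalar (tsum f).
Proof.
move=> fl fr; apply: (@tsum_is_linear F U V F^o f); split; [exact: fl|exact: fr].
Qed.

Lemma tsum_functional_tens (f : U -> V -> F) u v :
    (forall v, scalar (f^~ v)) -> (forall u, scalar (f u)) ->
  tsum f (u ⊗ v) = f u v.
Proof.
by move=> fl fr; apply: (@tsum_tens F U V F^o f); split; [exact: fl|exact: fr].
Qed.

(** A bilinear [f] induces a linear functional, which commutes with finite sums. This carries a
    functional through the nested sums in a formula for [comul]. *)
Lemma tsum_functional_tsum (U' V' : lmodType F) (f : U -> V -> F)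
    (g : U' -> V' -> tensor U V) (t : tensor U' V') :
    (forall v, scalar (f^~ v)) -> (forall u, scalar (f u)) ->
  tsum f (tsum g t) = \tsum_(a, b <- t) tsum f (g a b).
Proof.
move=> fl fr; have flin := tsum_functional_linear fl fr.
have f0 : tsum f 0 = 0.
  by have := flin (-1) 0 0; rewrite scaler0 addr0 mulN1r addNr.
have fD x y : tsum f (x + y) = tsum f x + tsum f y.
  by have := flin 1 x y; rewrite scale1r mul1r.
rewrite {2 3}/tsum; exact: (big_morph _ fD f0).
Qed.

End SweedlerSums.

(** * Tensor product of two pairings and its kernels *)

Section TensorPairing.
Variables (F : fieldType) (U V U' V' : lmodType F).
Variables (p1 : {bilinear U -> U' -> F | *%R & *%R})
          (p2 : {bilinear V -> V' -> F | *%R & *%R}).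

Definition tensor_pairing (x : tensor U V) (y : tensor U' V') : F :=
  \tsum_(u, v <- x) \tsum_(u', v' <- y) (p1 u u' * p2 v v').

Let term_linearl u' v v' : scalar (fun u => p1 u u' * p2 v v').
Proof. by move=> a u w; rewrite linearPl mulrDl mulrA. Qed.

Let term_linearr u u' v' : scalar (fun v => p1 u u' * p2 v v').
Proof. by move=> a v w; rewrite linearPl mulrDr mulrCA. Qed.

Let term_linearl' u v v' : scalar (fun u' => p1 u u' * p2 v v').
Proof. by move=> a u' w; rewrite linearPr mulrDl mulrA. Qed.

Let term_linearr' u u' v : scalar (fun v' => p1 u u' * p2 v v').
Proof. by move=> a v' w; rewrite linearPr mulrDr mulrCA. Qed.

Lemma tensor_pairing_bilinear : bilinear_for *%R *%R tensor_pairing.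
Proof.
split=> [y|x].
  by apply: tsum_functional_linear => [v|u]; apply: tsum_linear.
by apply: tsum_linear => u v; apply: tsum_functional_linear.
Qed.

HB.instance Definition _ :=
  bilinear_isBilinear.Build F (tensor U V) (tensor U' V') F *%R *%R
    tensor_pairing tensor_pairing_bilinear.

Lemma tensor_pairing_tens u v u' v' :
  tensor_pairing (u ⊗ v) (u' ⊗ v') = p1 u u' * p2 v v'.
Proof.
rewrite /tensor_pairing tsum_functional_tens => [|w|w]; last 2 first.
- exact: tsum_linear.
- exact: tsum_linear.
by rewrite tsum_functional_tens.
Qed.

(* Induction on the number of terms: if [p2 v v'] is nonzero for a term [u ⊗ v],
   then nondegeneracy of [p1] expresses [u] through the other terms. *)
Lemma tensor_pairing_left_kernel :
    (forall u, (forall u', p1 u u' = 0) -> u = 0) ->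
    (forall v, (forall v', p2 v v' = 0) -> v = 0) ->
  forall x, (forall u' v', tensor_pairing x (u' ⊗ v') = 0) -> x = 0.
Proof.
move=> nd1 nd2 x; rewrite -(tensor_decomp x) /tsum.
(* The induction is on the length rather than on the list, because the hypothesis is applied to a
   modified tail [s']. *)
move: (repr x) => {x} s; move: {2}(size s) (erefl (size s)) => n.
elim: n s => [[]// *|n IHn [//|[u v] s] /= [sz]]; first by rewrite big_nil.
rewrite big_cons /= => zero.
(* For fixed [v'], contracting the second factor with [v'] leaves a vector of [U] that [p1] pairs to
   zero with every [u']. *)
have zeroE u' v' : p1 (p2 v v' *: u + \sum_(i <- s) p2 i.2 v' *: i.1) u' = 0.
  rewrite -(zero u' v') [LHS]linearDl [RHS]linearDl /=; congr (_ + _).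
    by rewrite tensor_pairing_tens linearZl_LR mulrC.
  rewrite [LHS]linear_sumlz [RHS]linear_sumlz; apply: eq_bigr => i _ /=.
  by rewrite tensor_pairing_tens linearZl_LR mulrC.
have [v0|] := pselect (forall v', p2 v v' = 0).
  move: zero; rewrite (nd2 _ v0) linear0r add0r; exact: IHn.
move=> /existsNP[v' /eqP c0]; set c := p2 v v' in c0.
have uE : u = - \sum_(i <- s) (c^-1 * p2 i.2 v') *: i.1.
  have /(nd1 _)/eqP := fun u' => zeroE u' v'.
  rewrite addr_eq0 => /eqP /(congr1 ( *:%R c^-1)).
  rewrite scalerA mulVf // scale1r scalerN scaler_sumr => ->.
  by congr (- _); apply: eq_bigr => i _; rewrite scalerA.
(* Substituting [uE] into [u ⊗ v] spreads this term over the second components of the others, so one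
   summand disappears. *)
pose s' := [seq (i.1, i.2 - (c^-1 * p2 i.2 v') *: v) | i <- s].
have sE : u ⊗ v + \sum_(i <- s) i.1 ⊗ i.2 = \sum_(i <- s') i.1 ⊗ i.2.
  rewrite big_map {1}uE linearNl linear_sumlz addrC -sumrB.
  by apply: eq_bigr => i _ /=; rewrite linearBr linearZl_LR linearZr_LR.
by move: zero; rewrite sE; apply: IHn; rewrite size_map.
Qed.

End TensorPairing.

(** This is the left kernel statement for the flipped pairings [q1] and [q2]; the two Sweedler sums
    trade places. *)
Lemma tensor_pairing_right_kernel (F : fieldType) (U V U' V' : lmodType F)
    (p1 : {bilinear U -> U' -> F | *%R & *%R})
    (p2 : {bilinear V -> V' -> F | *%R & *%R}) :
    (forall u', (forall u, p1 u u' = 0) -> u' = 0) ->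
    (forall v', (forall v, p2 v v' = 0) -> v' = 0) ->
  forall y, (forall u v, tensor_pairing p1 p2 (u ⊗ v) y = 0) -> y = 0.
Proof.
move=> nd1 nd2 y zero.
have flip (A B : lmodType F) (p : {bilinear A -> B -> F | *%R & *%R}) :
    bilinear_for *%R *%R (fun b a => p a b).
  by split=> [a|b] c x z; rewrite ?linearPr ?linearPl.
pose q1 : {bilinear U' -> U -> F | *%R & *%R} := HB.pack (fun b a => p1 a b)
  (bilinear_isBilinear.Build F U' U F *%R *%R _ (flip _ _ p1)).
pose q2 : {bilinear V' -> V -> F | *%R & *%R} := HB.pack (fun b a => p2 a b)
  (bilinear_isBilinear.Build F V' V F *%R *%R _ (flip _ _ p2)).
apply: (@tensor_pairing_left_kernel _ _ _ _ _ q1 q2) => // u v.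
by rewrite -(zero u v) /tensor_pairing exchange_tsum.
Qed.

(** * Compatibility of a bialgebra pairing with antipodes *)

Section HopfPairings.
Variables (F : fieldType).

(** The functional induced by [f] on the triple tensor product is applied to both sides of
    [comulA]. *)
Lemma comulA_functional (A : hopfType F) (f : A -> A -> A -> F) (x : A) :
    (forall b c, scalar (fun a => f a b c)) ->
    (forall a c, scalar (fun b => f a b c)) ->
    (forall a b, scalar (f a b)) ->
  \tsum_(a, b <- comul x) \tsum_(c, d <- comul a) f c d b
  = \tsum_(a, b <- comul x) \tsum_(c, d <- comul b) f a c d.
Proof.
move=> f1 f2 f3.
pose g a (t : tensor A A) := tsum (f a) t.
have g1 t : scalar (g^~ t) by apply: tsum_linear.
have g2 a : scalar (g a) by apply: tsum_functional_linear.
have := congr1 (tsum g) (comulA x); rewrite !tsum_functional_tsum // => gE.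
transitivity (\tsum_(a, b <- comul x) tsum g (\tsum_(c, d <- comul a) (c ⊗ (d ⊗ b)))).
  apply: eq_tsum => a b; rewrite tsum_functional_tsum //.
  apply: eq_tsum => c d; rewrite tsum_functional_tens // /g.
  by rewrite tsum_functional_tens.
by rewrite gE; apply: eq_tsum => a b; rewrite tsum_functional_tens.
Qed.

Variables (H H' : hopfType F) (p : {bilinear H -> H' -> F | *%R & *%R}).

Lemma pair_antipode_of_bialgebra :
    (forall h h' k', p h (h' * k') = \tsum_(h1, h2 <- comul h) (p h1 h' * p h2 k')) ->
    (forall h, p h 1 = counit h) ->
    (forall h k h',
       \tsum_(h'1, h'2 <- comul h') (p h h'1 * p k h'2) = p (h * k) h') ->
    (forall h', counit h' = p 1 h') ->
  forall h h', p h (antipode h') = p (antipode h) h'.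
Proof.
move=> pM p1 pMl p1l h h'.
(* Summand of the triple convolution of [p (antipode _) _], [p] and [p _ (antipode _)]. Its two
   bracketings give the two sides of the claim. *)
pose f c d b c' d' b' := p (antipode c) c' * p d d' * p b (antipode b').
have left_inv a a' : \tsum_(c, d <- comul a) \tsum_(c', d' <- comul a')
    (p (antipode c) c' * p d d') = counit a * counit a'.
  transitivity (p (\tsum_(c, d <- comul a) (antipode c * d)) a').
    by under eq_tsum do rewrite pMl; rewrite /tsum linear_sumlz.
  by rewrite antipode_comul linearZl_LR /= -p1l.
have right_inv b b' : \tsum_(c, d <- comul b) \tsum_(c', d' <- comul b')
    (p c c' * p d (antipode d')) = counit b * counit b'.
  transitivity (p b (\tsum_(c', d' <- comul b') (c' * antipode d'))).
    by rewrite exchange_tsum; under eq_tsum do rewrite -pM; rewrite /tsum linear_sumr.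
  by rewrite comul_antipode linearZr_LR /= p1 mulrC.
(* Bracketed to the left: [left_inv] collapses the first two factors to counits, which the counit
   axioms absorb. *)
transitivity (\tsum_(a, b <- comul h) \tsum_(c, d <- comul a)
  \tsum_(a', b' <- comul h') \tsum_(c', d' <- comul a') f c d b c' d' b').
  rewrite -{1}(counit_comul h) -{1}(counit_comul h').
  rewrite /tsum linear_sumlz; apply: eq_bigr => -[a b] _ /=.
  rewrite exchange_big /= !linear_sum; apply: eq_bigr => -[a' b'] _ /=.
  rewrite linearZl_LR linearZ linearZr_LR /f /= mulrA -left_inv /tsum mulr_suml.
  by apply: eq_bigr => i _; rewrite mulr_suml.
(* Coassociativity in [H] and in [H'] moves the brackets to the right. *)
transitivity (\tsum_(a, b <- comul h) \tsum_(c, d <- comul b)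
  \tsum_(a', b' <- comul h') \tsum_(c', d' <- comul b') f a c d a' c' d').
  rewrite (comulA_functional (f := fun c d b => \tsum_(a', b' <- comul h')
    \tsum_(c', d' <- comul a') f c d b c' d' b')).
  - apply: eq_tsum => a b; apply: eq_tsum => c d.
    rewrite (comulA_functional (f := f a c d)) //= => u v k w z; rewrite /f.
    + by rewrite linearPr !mulrDl !mulrA.
    + by rewrite linearPr !(mulrDl, mulrDr) !mulrA (mulrC _ k).
    + by rewrite linearP linearPr mulrDr mulrCA.
  - move=> u v; apply: tsum_linear => a' b'; apply: tsum_linear => c' d' k w z.
    by rewrite /f linearP linearPl !mulrDl !mulrA.
  - move=> u v; apply: tsum_linear => a' b'; apply: tsum_linear => c' d' k w z.
    by rewrite /f linearPl !(mulrDl, mulrDr) !mulrA (mulrC _ k).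
  - move=> u v; apply: tsum_linear => a' b'; apply: tsum_linear => c' d' k w z.
    by rewrite /f linearPl mulrDr mulrCA.
(* Now [right_inv] collapses the last two factors. *)
rewrite -[in RHS](comul_counit h) -[in RHS](comul_counit h').
rewrite /tsum (linear_sum (@antipode F H)) linear_sumlz; apply: eq_bigr => -[a b] _ /=.
rewrite exchange_big linear_sumr; apply: eq_bigr => -[a' b'] _ /=.
rewrite (linearZ_LR (@antipode F H)) linearZl_LR linearZr_LR /f /= mulrA -right_inv /tsum mulr_suml.
apply: eq_bigr => i _; rewrite mulr_suml; apply: eq_bigr => j _ /=.
by rewrite -mulrA mulrC.
Qed.

End HopfPairings.

(** * Reduction to pure tensors, and units of bicrossproducts *)

(** Pure tensors span and [phi] is onto. Identities in [H] can thus be checked on the elements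
    written $kl$. *)
Lemma eq_scalar_tens (F : fieldType) (U V W : lmodType F)
    (phi : {linear tensor U V -> W}) (f g : W -> F) :
    bijective phi -> scalar f -> scalar g ->
    (forall u v, f (phi (u ⊗ v)) = g (phi (u ⊗ v))) ->
  f =1 g.
Proof.
move=> [psi _ psiK] flin glin fg w; rewrite -(psiK w).
have lin0 (h : W -> F) : scalar h -> h 0 = 0.
  by move=> hlin; have := hlin (-1) 0 0; rewrite scaler0 addr0 mulN1r addNr.
have linD (h : W -> F) x y : scalar h -> h (x + y) = h x + h y.
  by move=> hlin; have := hlin 1 x y; rewrite scale1r mul1r.
elim/tensor_ind: (psi w) => [|x y fgx fgy|u v].
- by rewrite linear0 !lin0.
- by rewrite linearD !linD // fgx fgy.
- exact: fg.
Qed.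

(** The product formula, with [ract_one] and the counit axiom of [K], makes [phi (1 ⊗ 1)] a left
    unit; applied to [1] it gives [1]. *)
Lemma right_left_bicrossproduct_one (F : fieldType) (K L H : hopfType F)
    (act : {bilinear L -> K -> L}) (coact : {linear K -> tensor L K})
    (phi : {linear tensor K L -> H}) :
  right_left_bicrossproduct act coact phi -> phi (1 ⊗ 1) = 1.
Proof.
move=> hH; rewrite -[LHS]mulr1; have [psi _ psiK] := rl_bij hH.
rewrite -[in LHS](psiK 1) -[in RHS](psiK 1).
elim/tensor_ind: (psi 1) => [|x y IHx IHy|k l].
- by rewrite linear0 mulr0.
- by rewrite linearD mulrDr IHx IHy.
rewrite (rl_mul hH) -[in RHS](comul_counit k) /tsum linear_sumlz linear_sum.
apply: eq_bigr => -[a b] _ /=.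
rewrite (ract_one (rl_module_algebra hH)) mul1r mulr_algl.
by rewrite linearZl_LR linearZr_LR.
Qed.

(** Again a left unit: [comul 1] has the single term [1 ⊗ 1], and [1] acts as the identity. *)
Lemma left_right_bicrossproduct_one (F : fieldType) (K L H : hopfType F)
    (act : {bilinear L -> K -> K}) (coact : {linear L -> tensor L K})
    (phi : {linear tensor K L -> H}) :
  left_right_bicrossproduct act coact phi -> phi (1 ⊗ 1) = 1.
Proof.
move=> hH; rewrite -[LHS]mulr1; have [psi _ psiK] := lr_bij hH.
rewrite -[in LHS](psiK 1) -[in RHS](psiK 1).
elim/tensor_ind: (psi 1) => [|x y IHx IHy|k l].
- by rewrite linear0 mulr0.
- by rewrite linearD mulrDr IHx IHy.
rewrite (lr_mul hH) comul1 (@tsum_tens F L L H).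
  by rewrite (lact1 (lr_module_algebra hH)) !mul1r.
split=> [b|b] a x y /=.
  by rewrite linearPl mulrDr -scalerAr linearPl linearP.
by rewrite mulrDl -scalerAl linearPr linearP.
Qed.

(** * Hopf axioms and nondegeneracy of the bicrossproduct pairing *)

Section BicrossproductPairing.
Variables (F : fieldType) (K L H Kd Ld Hd : hopfType F).
Variables (act : {bilinear L -> K -> L}) (coact : {linear K -> tensor L K}).
Variable phi : {linear tensor K L -> H}.
Hypothesis hH : right_left_bicrossproduct act coact phi.
Variables (p1 : {bilinear K -> Kd -> F | *%R & *%R})
          (p2 : {bilinear L -> Ld -> F | *%R & *%R}).
Hypotheses (hp1 : hopf_pairing p1) (hp2 : hopf_pairing p2).
Variables (actd : {bilinear Ld -> Kd -> Kd}) (coactd : {linear Ld -> tensor Ld Kd}).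
Variable phid : {linear tensor Kd Ld -> Hd}.
Hypothesis hact : dual_action_of_coaction p1 p2 coact actd.
Hypothesis hcoact : dual_coaction_of_action p1 p2 act coactd.
Hypothesis hHd : left_right_bicrossproduct actd coactd phid.
Variable p : {bilinear H -> Hd -> F | *%R & *%R}.
Hypothesis pE : forall k l κ λ, p (phi (k ⊗ l)) (phid (κ ⊗ λ)) = p1 k κ * p2 l λ.

(** It reduces both uniqueness and nondegeneracy to statements about [tensor_pairing]. *)
Lemma bicrossproduct_pairingE x y : p (phi x) (phid y) = tensor_pairing p1 p2 x y.
Proof.
elim/tensor_ind: x => [|x x' IHx IHx'|k l].
- by rewrite linear0 !linear0l.
- by rewrite linearD !linearDl IHx IHx'.
elim/tensor_ind: y => [|y y' IHy IHy'|κ λ].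
- by rewrite linear0 !linear0r.
- by rewrite linearD !linearDr IHy IHy'.
by rewrite pE tensor_pairing_tens.
Qed.

Lemma bicrossproduct_pair_mulr h h' k' :
  p h (h' * k') = \tsum_(h1, h2 <- comul h) (p h1 h' * p h2 k').
Proof.
have linl (A B : hopfType F) (q : {bilinear A -> B -> F | *%R & *%R}) b c :
    scalar (fun a => q a b * c).
  by move=> a u w; rewrite linearPl mulrDl mulrA.
have linr (A B : hopfType F) (q : {bilinear A -> B -> F | *%R & *%R}) b c :
    scalar (fun a => c * q a b).
  by move=> a u w; rewrite linearPl mulrDr mulrCA.
move: h; apply: (eq_scalar_tens (rl_bij hH)) => [a u w||k l].
- by rewrite linearPl.
- move=> a u w; rewrite linearP; exact: tsum_functional_linear.
move: h'; apply: (eq_scalar_tens (lr_bij hHd)) => [a u w||κ λ].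
- by rewrite mulrDl linearDr -scalerAl linearZr_LR.
- by apply: tsum_linear => u v a w w' /=; rewrite linearPr mulrDl mulrA.
move: k'; apply: (eq_scalar_tens (lr_bij hHd)) => [a u w||κ' λ'].
- by rewrite mulrDr linearDr -scalerAr linearZr_LR.
- by apply: tsum_linear => u v a w w' /=; rewrite linearPr mulrDr mulrCA.
rewrite (lr_mul hHd) (rl_comul hH) [LHS]linear_sumr /=.
(* Both sides equal this fourfold sum. On the left, [p1] and [p2] split the products in [Kd] and
   [Ld], and [hact] replaces the action by [coact]. *)
transitivity (\tsum_(λ1, λ2 <- comul λ) \tsum_(k1, k2 <- comul k)
  \tsum_(x, c <- coact k2) \tsum_(l1, l2 <- comul l)
  (p1 k1 κ * (p2 x λ1 * p1 c κ') * (p2 l1 λ2 * p2 l2 λ'))).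
  apply: eq_bigr => -[λ1 λ2] _ /=; rewrite pE (pair_mulr hp1) (pair_mulr hp2) mulr_tsuml.
  apply: eq_tsum => k1 k2; rewrite hact [p1 k1 κ * _]mulr_tsumr mulr_tsuml.
  by apply: eq_tsum => x c; rewrite mulr_tsumr.
(* The sum over [comul λ] is pushed to the innermost place, where it is the expansion of
   [p2 (x * l1) λ]. *)
rewrite exchange_tsum tsum_functional_tsum //; apply: eq_tsum => k1 k2.
rewrite exchange_tsum tsum_functional_tsum //; apply: eq_tsum => x c.
rewrite exchange_tsum tsum_functional_tsum //; apply: eq_tsum => l1 l2.
rewrite tsum_functional_tens // !pE -(pair_comulr hp2) mulr_tsumr mulr_tsuml.
apply: eq_tsum => λ1 λ2; rewrite -!mulrA; congr (_ * (_ * _)).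
by rewrite mulrCA.
Qed.

Lemma bicrossproduct_pair_comulr h k h' :
  \tsum_(h'1, h'2 <- comul h') (p h h'1 * p k h'2) = p (h * k) h'.
Proof.
have linl (A B : hopfType F) (q : {bilinear A -> B -> F | *%R & *%R}) b c :
    scalar (fun a => q b a * c).
  by move=> a u w; rewrite linearPr mulrDl mulrA.
have linr (A B : hopfType F) (q : {bilinear A -> B -> F | *%R & *%R}) b c :
    scalar (fun a => c * q b a).
  by move=> a u w; rewrite linearPr mulrDr mulrCA.
move: h'; apply: (eq_scalar_tens (lr_bij hHd)) => [a u w||κ λ].
- rewrite linearP; exact: tsum_functional_linear.
- by move=> a u w; rewrite linearPr.
move: h; apply: (eq_scalar_tens (rl_bij hH)) => [|a u w|k0 l].
- by apply: tsum_linear => u v a w w' /=; rewrite linearPl mulrDl mulrA.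
- by rewrite mulrDl linearDl -scalerAl linearZl_LR.
move: k; apply: (eq_scalar_tens (rl_bij hH)) => [|a u w|k' l'].
- by apply: tsum_linear => u v a w w' /=; rewrite linearPl mulrDr mulrCA.
- by rewrite mulrDr linearDl -scalerAr linearZl_LR.
rename k0 into k; rewrite (rl_mul hH) (lr_comul hHd) [RHS]linear_sumlz /=.
(* The dual computation: products in [K] and [L] split over [comul κ] and [comul λ], and [hcoact]
   replaces [act] by [coactd]. *)
transitivity (\tsum_(k'1, k'2 <- comul k') \tsum_(κ1, κ2 <- comul κ)
  \tsum_(λ1, λ2 <- comul λ) \tsum_(y, d <- coactd λ1)
  (p1 k κ1 * p1 k'1 κ2 * (p2 l y * p1 k'2 d * p2 l' λ2))); last first.
  apply: eq_bigr => -[k'1 k'2] _ /=; rewrite pE -(pair_comulr hp1) -(pair_comulr hp2).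
  rewrite mulr_tsuml; apply: eq_tsum => κ1 κ2; rewrite mulr_tsumr.
  by apply: eq_tsum => λ1 λ2; rewrite hcoact mulr_tsuml mulr_tsumr.
(* Here the sum over [comul k'] goes innermost, as the expansion of [p1 k' (κ2 * d)]. *)
rewrite exchange_tsum tsum_functional_tsum //; apply: eq_tsum => κ1 κ2.
rewrite exchange_tsum tsum_functional_tsum //; apply: eq_tsum => λ1 λ2.
rewrite exchange_tsum tsum_functional_tsum //; apply: eq_tsum => y d.
rewrite tsum_functional_tens // !pE (pair_mulr hp1) mulr_tsuml mulr_tsumr.
apply: eq_tsum => k'1 k'2; rewrite -!mulrA; congr (_ * _).
by rewrite mulrCA; congr (_ * _); rewrite mulrCA.
Qed.

Lemma bicrossproduct_hopf_pairing : hopf_pairing p.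
Proof.
have pair1 h : p h 1 = counit h.
  rewrite -(left_right_bicrossproduct_one hHd); move: h.
  apply: (eq_scalar_tens (rl_bij hH)) => [a u w|a u w|k l].
  - by rewrite linearPl.
  - by rewrite linearP.
  by rewrite pE (rl_counit hH) (pair_oner hp1) (pair_oner hp2).
have pair1l h' : counit h' = p 1 h'.
  rewrite -(right_left_bicrossproduct_one hH); move: h'.
  apply: (eq_scalar_tens (lr_bij hHd)) => [a u w|a u w|κ λ].
  - by rewrite linearP.
  - by rewrite linearPr.
  by rewrite pE (lr_counit hHd) (pair_onel hp1) (pair_onel hp2).
have pM := bicrossproduct_pair_mulr; have pMl := bicrossproduct_pair_comulr.
by split=> //; apply: pair_antipode_of_bialgebra.
Qed.

(** Since [phi] and [phid] are bijective, each kernel is read off from that of [tensor_pairing],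
    tested on pure tensors only. *)
Lemma bicrossproduct_nondegenerate_pairing :
  nondegenerate_pairing p1 -> nondegenerate_pairing p2 -> nondegenerate_pairing p.
Proof.
move=> [nd1 nd1'] [nd2 nd2']; split=> [h h0|h' h'0].
  have [psi _ psiK] := rl_bij hH; rewrite -(psiK h).
  rewrite (tensor_pairing_left_kernel nd1 nd2 (x := psi h)) ?linear0 // => κ λ.
  by rewrite -bicrossproduct_pairingE psiK.
have [psid _ psidK] := lr_bij hHd; rewrite -(psidK h').
rewrite (tensor_pairing_right_kernel nd1' nd2' (y := psid h')) ?linear0 // => k l.
by rewrite -bicrossproduct_pairingE psidK.
Qed.

End BicrossproductPairing.

(** * Existence of the pairing, and the theorem *)

(** The bilinear extension is [tensor_pairing] pulled back along the inverses of [phi] and [phi'],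
    which are again linear. *)
Lemma bijective_tensor_pairing (F : fieldType) (U V W U' V' W' : lmodType F)
    (p1 : {bilinear U -> U' -> F | *%R & *%R})
    (p2 : {bilinear V -> V' -> F | *%R & *%R})
    (phi : {linear tensor U V -> W}) (phi' : {linear tensor U' V' -> W'}) :
    bijective phi -> bijective phi' ->
  exists p : {bilinear W -> W' -> F | *%R & *%R},
    forall u v u' v', p (phi (u ⊗ v)) (phi' (u' ⊗ v')) = p1 u u' * p2 v v'.
Proof.
move=> [psi phiK psiK] [psi' phi'K psi'K].
have psi_lin := can2_linear phiK psiK; have psi'_lin := can2_linear phi'K psi'K.
pose q w w' := tensor_pairing p1 p2 (psi w) (psi' w').
have qbil : bilinear_for *%R *%R q.
  by split=> [w'|w] a x y; rewrite /q ?psi_lin ?psi'_lin ?linearPl ?linearPr.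
pose p : {bilinear W -> W' -> F | *%R & *%R} := HB.pack q
  (bilinear_isBilinear.Build F W W' F *%R *%R q qbil).
exists p => u v u' v'.
by rewrite /= /q phiK phi'K tensor_pairing_tens.
Qed.

Theorem theorem2p1 (R : realType) (s : scalars)
    (K L H Kd Ld Hd : hopfType (scalar_field R s))
    (* H = K ▷◀ L *)
    (act : {bilinear L -> K -> L}) (coact : {linear K -> tensor L K})
    (phi : {linear tensor K L -> H})
    (hH : right_left_bicrossproduct act coact phi)
    (* pairings of (K, K^* ) and (L, L^* ) *)
    (p1 : {bilinear K -> Kd -> scalar_field R s | *%R & *%R})
    (hp1 : hopf_pairing p1) (nd1 : nondegenerate_pairing p1)
    (p2 : {bilinear L -> Ld -> scalar_field R s | *%R & *%R})
    (hp2 : hopf_pairing p2) (nd2 : nondegenerate_pairing p2)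
    (* H^* = K^* ▶◁ L^* , dual to H *)
    (actd : {bilinear Ld -> Kd -> Kd}) (coactd : {linear Ld -> tensor Ld Kd})
    (phid : {linear tensor Kd Ld -> Hd})
    (hact : dual_action_of_coaction p1 p2 coact actd)
    (hcoact : dual_coaction_of_action p1 p2 act coactd)
    (hHd : left_right_bicrossproduct actd coactd phid) :
  exists p : {bilinear H -> Hd -> scalar_field R s | *%R & *%R},
    [/\ forall k l κ λ, p (phi (k ⊗ l)) (phid (κ ⊗ λ)) = p1 k κ * p2 l λ,
        forall q : {bilinear H -> Hd -> scalar_field R s | *%R & *%R},
          (forall k l κ λ, q (phi (k ⊗ l)) (phid (κ ⊗ λ)) = p1 k κ * p2 l λ) ->
          forall h h', q h h' = p h h',
        hopf_pairing p
      & nondegenerate_pairing p].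
Proof.
have [p pE] := bijective_tensor_pairing p1 p2 (rl_bij hH) (lr_bij hHd).
exists p; split=> // [q qE h h'||].
(* Uniqueness: transported to the tensor products, [q] and [p] are both [tensor_pairing p1 p2]. *)
- have [psi _ psiK] := rl_bij hH; have [psid _ psidK] := lr_bij hHd.
  rewrite -(psiK h) -(psidK h').
  by rewrite (bicrossproduct_pairingE qE) (bicrossproduct_pairingE pE).
- exact: (bicrossproduct_hopf_pairing hH hp1 hp2 hact hcoact hHd pE).
- exact: (bicrossproduct_nondegenerate_pairing hH hHd pE nd1 nd2).
Qed.
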